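(* Let $m\ge 0$ be an integer, let $q>1$ be real, and consider the quantum power time scale $\mathbb{R}^q$ with forward jump operator $\sigma(t)=t^q$, and $\Lambda^2=\mathbb{R}^q\times\mathbb{R}^q$. Let $P(m,b,x)$ be the polynomial defined in the context. Then for every real $t>0$ with $t^q\ne t$, $$\mathcal{D}_q t^{2m+1}=\frac{\partial P(m,b,x)}{\Delta x}(m,\sigma(t),t)+\frac{\partial P(m,b,x)}{\Delta b}(m,t,t),$$ where $\mathcal{D}_q f(t)=\frac{f(t^q)-f(t)}{t^q-t}$ is the $q$-power derivative and $\mathcal{D}_q t^{2m+1}$ denotes its value at $t$ for $f(x)=x^{2m+1}$.
   Context: The polynomial $P$. Define real coefficients $\mathbf{A}_{m,r}$, $0\le r\le m$, recursively (downward in $r$) by $\mathbf{A}_{m,m}=(2m+1)\binom{2m}{m}$ and, for $0\le r<m$, $\mathbf{A}_{m,r}=(2r+1)\binom{2r}{r}\sum_{d=2r+1}^{m}\mathbf{A}_{m,d}\binom{d}{2r+1}\frac{(-1)^{d-1}}{d-r}B_{2d-2r}$, where $B_k$ are the Bernoulli numbers (an empty sum is $0$). For nonnegative integers $b$, $P(m,b,x)=\sum_{k=0}^{b-1}\sum_{r=0}^{m}\mathbf{A}_{m,r}\,k^r(x-k)^r$ with the convention $0^0=1$. This is a polynomial in $x$ and $b$, and for arbitrary real $b,x$ the symbol $P(m,b,x)$ denotes the value of the unique polynomial in $b$ and $x$ that agrees with this sum for all nonnegative integers $b$ and all real $x$. Partial derivatives with respect to the jump $\sigma$ (arguments listed in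 the order $(m,b,x)$): $\frac{\partial P(m,b,x)}{\Delta x}(m,c,t)=\frac{P(m,c,\sigma(t))-P(m,c,t)}{\sigma(t)-t}$ and $\frac{\partial P(m,b,x)}{\Delta b}(m,t,c)=\frac{P(m,\sigma(t),c)-P(m,t,c)}{\sigma(t)-t}$. *)

(* Defs.v *)
From mathcomp Require Import all_boot all_order all_algebra.
From mathcomp Require Import boolp classical_sets reals topology normedtype exp.
From mathcomp Require Import ring.

Set Implicit Arguments.
Unset Strict Implicit.
Unset Printing Implicit Defensive.

Import Order.TTheory GRing.Theory Num.Theory.

Local Open Scope ring_scope.

(* bernoulli_seq R n = [:: B_0; ...; B_(n-1)], computed from
   \sum_(k <= n) 'C(n+1, k) B_k = 0 for n > 0 (so that B_1 = -1/2). *)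
Fixpoint bernoulli_seq (R : fieldType) (n : nat) : seq R :=
  if n is n'.+1 then
    let s := bernoulli_seq R n' in
    rcons s (if n' == 0%N then 1
             else - (n'.+1%:R)^-1 * \sum_(k < n') 'C(n'.+1, k)%:R * s`_k)
  else [::].

Definition bernoulli (R : fieldType) (n : nat) : R :=
  (bernoulli_seq R n.+1)`_n.

(* The first argument n is fuel: each recursive call increases r, so the value
   does not depend on n once m < n + r (see coefA_rec_fuel). *)
Fixpoint coefA_rec (R : fieldType) (n m r : nat) : R :=
  if n is n'.+1 then
    if r == m then ((2 * m).+1 * 'C(2 * m, m))%:R
    else ((2 * r).+1 * 'C(2 * r, r))%:R *
         \sum_((2 * r).+1 <= d < m.+1)
           coefA_rec R n' m d * 'C(d, (2 * r).+1)%:R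
           * ((-1) ^+ d.-1 / (d - r)%:R) * bernoulli R (2 * d - 2 * r)
  else 0.

Definition coefA (R : fieldType) (m r : nat) : R := coefA_rec R m.+1 m r.

(* The value of P(m, b, x) at a nonnegative integer b; x ^+ 0 = 1 for all x. *)
Definition sumP (R : fieldType) (m b : nat) (x : R) : R :=
  \sum_(k < b) \sum_(r < m.+1) coefA R m r * k%:R ^+ r * (x - k%:R) ^+ r.

(* Bivariate polynomials are polynomials in b over the polynomials in x:
   p.[b, x] = p.[b%:P].[x]. *)
Definition agreesP (R : fieldType) (m : nat) : set {poly {poly R}} :=
  [set p | forall (b : nat) (x : R), p.[b%:R, x] = sumP m b x].
Arguments agreesP : clear implicits.

(* The unique bivariate polynomial in agreesP R m: over a numFieldType,
   existence and uniqueness are agreesP_exists and agreesP_unique, so the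
   default 0 is never used. *)
Definition polyP (R : fieldType) (m : nat) : {poly {poly R}} :=
  xget 0 (agreesP R m).

Definition P (R : fieldType) (m : nat) (b x : R) : R := (polyP R m).[b, x].

Definition qpower_jump (R : realType) (q t : R) : R := t `^ q.

Definition qpower_derive (R : realType) (q : R) (f : R -> R) (t : R) : R :=
  (f (t `^ q) - f t) / (t `^ q - t).

(* Partial derivatives, with respect to the jump sigma, of a function of
   (b, x), at the point (b, x). *)
Definition jump_derive_x (R : fieldType) (sigma : R -> R) (f : R -> R -> R)
    (b x : R) : R :=
  (f b (sigma x) - f b x) / (sigma x - x).

Definition jump_derive_b (R : fieldType) (sigma : R -> R) (f : R -> R -> R)
    (b x : R) : R :=
  (f (sigma b) x - f b x) / (sigma b - b).

Lemma size_bernoulli_seq (R : fieldType) n : size (bernoulli_seq R n) = n.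
Proof. by elim: n => //= n IHn; rewrite size_rcons IHn. Qed.

Lemma nth_bernoulli_seq (R : fieldType) n k :
  (k < n)%N -> (bernoulli_seq R n)`_k = bernoulli R k.
Proof.
elim: n => // n IHn; rewrite ltnS leq_eqVlt => /predU1P[-> //|ltkn].
by rewrite /= nth_rcons size_bernoulli_seq ltkn IHn.
Qed.

Lemma bernoulli0 (R : fieldType) : bernoulli R 0 = 1.
Proof. by []. Qed.

Lemma bernoulli_sum (R : numFieldType) n : (0 < n)%N ->
  \sum_(k < n.+1) 'C(n.+1, k)%:R * bernoulli R k = 0.
Proof.
move=> n_gt0; rewrite big_ord_recr /= {2}/bernoulli /=.
rewrite nth_rcons size_bernoulli_seq ltnn eqxx gtn_eqF //.
rewrite binSn mulrA mulrN divff ?pnatr_eq0 // mulN1r.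
apply/eqP; rewrite subr_eq0; apply/eqP/eq_bigr => k _.
by rewrite nth_bernoulli_seq.
Qed.

Lemma coefA_rec_gt (R : fieldType) n m r : (m < r)%N -> coefA_rec R n m r = 0.
Proof.
case: n => //= n ltmr; rewrite gtn_eqF // big_geq ?mulr0 //.
by rewrite ltnS (leq_trans (ltnW ltmr)) // leq_pmull.
Qed.

Lemma coefA_rec_fuel (R : fieldType) n n' m r :
  (m < n + r)%N -> (m < n' + r)%N -> coefA_rec R n m r = coefA_rec R n' m r.
Proof.
elim: n n' r => [|n IHn] [|n'] r lt1 lt2 //.
- by rewrite [RHS]coefA_rec_gt.
- by rewrite [LHS]coefA_rec_gt.
rewrite /=; case: eqP => // _; congr (_ * _).
apply: eq_big_nat => d /andP[ltrd _]; congr (_ * _ * _ * _).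
have {}ltrd : (r < d)%N by apply: leq_ltn_trans ltrd; rewrite leq_pmull.
apply: IHn; [apply: leq_trans lt1 _ | apply: leq_trans lt2 _];
  by rewrite addSnnS leq_add2l.
Qed.

Lemma coefA_diag (R : fieldType) m :
  coefA R m m = ((2 * m).+1 * 'C(2 * m, m))%:R.
Proof. by rewrite /coefA /= eqxx. Qed.

Lemma coefA_below (R : fieldType) m r : (r < m)%N ->
  coefA R m r = ((2 * r).+1 * 'C(2 * r, r))%:R *
    \sum_((2 * r).+1 <= d < m.+1)
      coefA R m d * 'C(d, (2 * r).+1)%:R
      * ((-1) ^+ d.-1 / (d - r)%:R) * bernoulli R (2 * d - 2 * r).
Proof.
move=> ltrm; rewrite {1}/coefA [LHS]/= ltn_eqF //; congr (_ * _).
apply: eq_big_nat => d /andP[ltrd _]; congr (_ * _ * _ * _).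
apply: coefA_rec_fuel; last by rewrite addSn ltnS leq_addr.
by rewrite -addn1 leq_add2l; apply: leq_ltn_trans ltrd.
Qed.

Lemma power_sum_poly (R : numFieldType) n : exists s : {poly R},
  forall b : nat, s.[b%:R] = \sum_(k < b) k%:R ^+ n.
Proof.
elim/ltn_ind: n => n IHn.
have /choice[s sE] : forall i : 'I_n, exists s : {poly R},
    forall b : nat, s.[b%:R] = \sum_(k < b) k%:R ^+ i.
  by move=> i; apply: IHn.
exists (n.+1%:R^-1 *: ('X^(n.+1) - \sum_(i < n) 'C(n.+1, i)%:R *: s i)) => b.
rewrite !hornerE horner_sum.
apply: (mulfI (_ : n.+1%:R != 0)); first by rewrite pnatr_eq0.
rewrite mulrA divff ?pnatr_eq0 // mul1r.
under eq_bigr do rewrite hornerZ sE.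
elim: b => [|b IHb].
  rewrite big_ord0 mulr0 expr0n sub0r big1 ?oppr0 // => i _.
  by rewrite big_ord0 mulr0.
rewrite big_ord_recr /= mulrDr -IHb.
under eq_bigr do rewrite big_ord_recr /= mulrDr.
rewrite big_split /= -natr1 [b%:R + 1]addrC exprDn !big_ord_recr /=.
under eq_bigr do rewrite expr1n mul1r -mulr_natl.
rewrite !expr1n !mul1r binSn binn -(mulr_natl _ n.+1); ring.
Qed.

Lemma poly_eq_nat (R : numFieldType) (S : idomainType)
    (f : {rmorphism R -> S}) (p q : {poly S}) :
  (forall n : nat, p.[f n%:R] = q.[f n%:R]) -> p = q.
Proof.
move=> eqpq; apply/eqP; rewrite -subr_eq0; apply/eqP.
apply: (@roots_geq_poly_eq0 _ _ [seq f n%:R | n <- iota 0 (size (p - q))]).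
- by apply/allP => _ /mapP[n _ ->]; rewrite /root !hornerE eqpq subrr.
- rewrite map_inj_uniq ?iota_uniq // => n1 n2 /fmorph_inj/eqP.
  by rewrite eqr_nat => /eqP.
- by rewrite size_map size_iota.
Qed.

Lemma agreesP_inj (R : numFieldType) m p q :
  agreesP R m p -> agreesP R m q -> p = q.
Proof.
move=> pP qP; apply: (@poly_eq_nat R _ polyC) => b.
by apply: (@poly_eq_nat R _ idfun) => n; rewrite pP qP.
Qed.

Lemma agreesP_exists (R : numFieldType) m : agreesP R m (polyP R m).
Proof.
have /choice[s sE] := @power_sum_poly R.
apply: xgetPex; exists (\sum_(r < m.+1) \sum_(j < r.+1)
  (coefA R m r * (-1) ^+ j * 'C(r, j)%:R *: 'X^(r - j)) *: (s (r + j)%N)^:P).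
move=> b x; rewrite /sumP exchange_big !horner_sum /=.
apply: eq_bigr => r _; rewrite !horner_sum.
under [RHS]eq_bigr do rewrite exprBn mulr_sumr.
rewrite exchange_big /=; apply: eq_bigr => j _.
rewrite hornerZ horner_map /= !hornerE sE mulr_sumr.
apply: eq_bigr => k _; rewrite exprD -mulr_natr; ring.
Qed.

Lemma agreesP_unique (R : numFieldType) m p : agreesP R m p -> p = polyP R m.
Proof. by move=> pP; apply: agreesP_inj pP (@agreesP_exists R m). Qed.

Lemma P_nat (R : numFieldType) m (b : nat) (x : R) : P m b%:R x = sumP m b x.
Proof. exact: agreesP_exists. Qed.

(* Main.v *)
Require Import Defs.
From mathcomp Require Import all_boot all_order all_algebra.
From mathcomp Require Import boolp classical_sets reals topology normedtype exp.
From mathcomp Require Import zify ring.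

Import Order.TTheory GRing.Theory Num.Theory.

Local Open Scope ring_scope.

(** Write s = t ^ q.  The two difference quotients have the same denominator
    s - t, and the first is taken at b = s, so that the terms P(m, s, t)
    cancel and the right-hand side is (P(m, s, s) - P(m, t, t)) / (s - t).
    Everything therefore reduces to the identity P(m, x, x) = x ^ (2m+1)
    ([P_diag]).  Both sides are polynomials in x, so it suffices to treat
    x = n a natural number, where P(m, n, n) is the defining sum ([sumP_diag]).

    That sum is \sum_r A_(m,r) S_r(n), with S_r(n) the sum of f(k) over k < n
    for f(x) = x^r (n - x)^r.  The Euler-Maclaurin formula, exact on
    polynomials, gives
      S_r(n) = \int_0^n f
               + \sum_(j >= 0) B_(j+1)/(j+1)! (f^(j)(n) - f^(j)(0)).
    The integral is the Beta integral n^(2r+1) / ((2r+1) 'C(2r, r)).  Since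
    f(n - x) = f(x), one has f^(j)(n) = (-1)^j f^(j)(0): only odd j contribute,
    each with the factor -2, and f^(j)(0)/j! is a coefficient of f, read off
    from the binomial theorem.  Hence ([sum_symXn])
      S_r(n) = n^(2r+1) / ((2r+1) 'C(2r, r))
        + \sum_(s < r) (-1)^r 'C(r, 2s+1) B_(2r-2s) / (r - s) n^(2s+1).
    In \sum_r A_(m,r) S_r(n) the coefficient of n^(2s+1), s < m, vanishes:
    this is exactly the recursion that defines A_(m,s).  The coefficient of
    n^(2m+1) is 1 by the choice of A_(m,m). *)

Lemma bernoulli_sum_lt (R : numFieldType) s :
  \sum_(i < s) 'C(s, i)%:R * bernoulli R i = (s == 1%N)%:R.
Proof.
case: s => [|[|s]]; first by rewrite big_ord0.
  by rewrite big_ord1 bernoulli0 mul1r.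
exact: bernoulli_sum.
Qed.

Lemma nderivn_nderivn (R : nzSemiRingType) (F : {poly R}) i j :
  (F^`N(i))^`N(j) = F^`N(i + j) *+ 'C(i + j, i).
Proof.
apply/polyP => k; rewrite coefMn !coef_nderivn -!mulrnA addnA; congr (_ *+ _).
(* Both sides are the trinomial coefficient (i + j + k)! / (i! j! k!). *)
apply/eqP; rewrite -(eqn_pmul2r (fact_gt0 i)) -(eqn_pmul2r (fact_gt0 j)).
rewrite -(eqn_pmul2r (fact_gt0 k)).
have := bin_fact (leq_addr (j + k) i); have := bin_fact (leq_addr k j).
have := bin_fact (leq_addr k (i + j)); have := bin_fact (leq_addr j i).
rewrite !addKn addnA => binE1 binE2 binE3 binE4.
apply/eqP; transitivity ((i + j + k)`!)%N.
  by rewrite -binE4 -binE3; ring.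
by rewrite -binE2 -binE1; ring.
Qed.

Lemma nderivn_deriv (R : nzSemiRingType) (F : {poly R}) i :
  (F^`())^`N(i) = F^`N(i.+1) *+ i.+1.
Proof. by rewrite -nderivn1 nderivn_nderivn bin1. Qed.

(** Taylor's formula for the i-th Hasse derivative, re-indexed by the order
    s = i + j of the derivatives of F; the terms s < i vanish with 'C(s, i), so
    that the range of s does not depend on i. *)
Lemma nderivn_shift (R : comNzRingType) (F : {poly R}) N i x :
  (size F <= N)%N ->
  F^`N(i).[x + 1] = \sum_(s < N) 'C(s, i)%:R * F^`N(s).[x].
Proof.
move=> leFN.
have sizeNi : (size F^`N(i) <= N)%N.
  apply/leq_sizeP => j leNj; rewrite coef_nderivn nth_default ?mul0rn //.
  by rewrite (leq_trans leFN) // (leq_trans leNj) ?leq_addl.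
rewrite (nderiv_taylor_wide (mulrC x 1) sizeNi).
under eq_bigr do
  rewrite expr1n mulr1 nderivn_nderivn hornerMn -mulr_natl.
set G := fun s => 'C(s, i)%:R * F^`N(s).[x].
have G0 s : (N <= s)%N -> G s = 0.
  by move=> leNs; rewrite /G nderivn_poly0 ?(leq_trans leFN) // horner0 mulr0.
transitivity (\sum_(0 <= s < N + i) G s).
  rewrite -(big_mkord xpredT (fun j => G (i + j)%N)).
  rewrite [RHS](big_cat_nat (n := i)) ?leq_addl //= [X in X + _]big_nat_cond.
  rewrite [X in X + _]big1 => [|s /andP[/andP[_ ltsi] _]]; last first.
    by rewrite /G bin_small // mul0r.
  rewrite add0r -{2}[i]add0n big_addn addnK.
  by apply: eq_bigr => j _; rewrite addnC.
rewrite (big_cat_nat (n := N)) ?leq_addr //= [X in _ + X]big_nat_cond.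
rewrite [X in _ + X]big1 => [|s /andP[/andP[leNs _] _]]; last exact: G0.
by rewrite addr0 big_mkord.
Qed.

(** The operator identity D = \sum_i B_i / i! D^i (exp D - 1).  Expanding the
    shift by Taylor's formula, the s-th Hasse derivative receives the
    coefficient \sum_(i < s) 'C(s, i) B_i, which is 0 unless s = 1. *)
Lemma deriv_euler_maclaurin (R : numFieldType) (F : {poly R}) N x :
  (size F <= N)%N ->
  \sum_(i < N) bernoulli R i * (F^`N(i).[x + 1] - F^`N(i).[x]) = F^`().[x].
Proof.
move=> leFN.
under eq_bigr do rewrite (nderivn_shift _ _ _ _ _ leFN) mulrBr mulr_sumr.
rewrite sumrB exchange_big -sumrB /=.
transitivity (\sum_(s < N) F^`N(s).[x] * ((s : nat) == 1%N)%:R).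
  apply: eq_bigr => s _; rewrite -bernoulli_sum_lt mulr_sumr.
  pose h i := bernoulli R i * ('C(s, i)%:R * F^`N(s).[x]).
  rewrite -(big_mkord xpredT h).
  rewrite (big_cat_nat (n := s.+1)) //= [X in _ + X - _]big_nat_cond.
  rewrite [X in _ + X - _]big1 => [|i /andP[/andP[ltsi _] _]]; last first.
    by rewrite /h bin_small // mul0r mulr0.
  rewrite addr0 big_nat_recr //= /h binn mul1r addrK big_mkord.
  by apply: eq_bigr => i _; ring.
case: (ltnP 1 N) => [lt1N | leN1].
  rewrite (bigD1 (Ordinal lt1N)) //= mulr1 nderivn1 big1 ?addr0 // => s.
  by rewrite -val_eqE /= => /negPf->; rewrite mulr0.
rewrite -nderivn1 nderivn_poly0 ?(leq_trans leFN) // horner0 big1 // => s _.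
by rewrite ltn_eqF ?mulr0 // (leq_trans (ltn_ord s)).
Qed.

Lemma sum_deriv_euler_maclaurin (R : numFieldType) (F : {poly R}) N n :
  (size F <= N)%N ->
  \sum_(k < n) F^`().[k%:R] =
  \sum_(i < N) bernoulli R i * (F^`N(i).[n%:R] - F^`N(i).[0]).
Proof.
move=> leFN.
rewrite (eq_bigr _ (fun i _ => esym (deriv_euler_maclaurin _ _ _ _ leFN))).
rewrite exchange_big; apply: eq_bigr => i _ /=.
rewrite -mulr_sumr; congr (_ * _).
rewrite -(big_mkord xpredT (fun k => F^`N(i).[k%:R + 1] - F^`N(i).[k%:R])).
under eq_bigr do rewrite natr1.
by rewrite telescope_sumr.
Qed.

(** The left-hand side is the Beta integral of x^a (1 - x)^b over [0, 1], with
    (1 - x)^b expanded.  Pascal's rule is the recursion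
    x^a (1-x)^(b+1) = x^a (1-x)^b - x^(a+1) (1-x)^b under the integral. *)
Lemma beta_sum (R : numFieldType) a b :
  \sum_(j < b.+1) (-1) ^+ j * 'C(b, j)%:R / (a + j).+1%:R =
  a`!%:R * b`!%:R / (a + b).+1`!%:R :> R.
Proof.
elim: b a => [|b IHb] a.
  rewrite big_ord1 addn0 bin0 expr0 !mul1r fact0 mulr1 factS natrM invfM.
  by rewrite mulrCA divff ?mulr1 // pnatr_eq0 -lt0n fact_gt0.
transitivity (a`!%:R * b`!%:R / (a + b).+1`!%:R
              - a.+1`!%:R * b`!%:R / (a.+1 + b).+1`!%:R : R).
  pose u j : R := (-1) ^+ j * 'C(b, j)%:R / (a + j).+1%:R.
  have -> : \sum_(j < b.+2) (-1) ^+ j * 'C(b.+1, j)%:R / (a + j).+1%:R =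
      \sum_(j < b.+2) u j
      - \sum_(j < b.+1) (-1) ^+ j * 'C(b, j)%:R / (a.+1 + j).+1%:R.
    rewrite !(big_ord_recl b.+1) /u /= !bin0 -addrA -sumrB; congr (_ + _).
    by apply: eq_bigr => j _; rewrite binS natrD addnS addSn exprS; ring.
  by rewrite big_ord_recr -!IHb {2}/u bin_small //= mulr0 mul0r addr0.
rewrite addSn addnS !(factS (a + b).+1) !factS !natrM.
have h1 : (a + b).+2%:R != 0 :> R by rewrite pnatr_eq0.
have h2 : (a + b).+1%:R != 0 :> R by rewrite pnatr_eq0.
have h3 : (a + b)`!%:R != 0 :> R by rewrite pnatr_eq0 -lt0n fact_gt0.
move: h1 h2.
rewrite -[a.+1]addn1 -[b.+1]addn1 -[(a + b).+2]addn2 -[(a + b).+1]addn1 !natrD.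
by move=> h1 h2; field; rewrite ?h1 ?h2 ?h3.
Qed.

Lemma horner_nderivn_reflect (R : numFieldType) (f : {poly R}) c j :
  f \Po (c%:P - 'X) = f -> f^`N(j).[c] = (-1) ^+ j * f^`N(j).[0].
Proof.
move=> fE; have derivnE : f^`(j) \Po (c%:P - 'X) = (-1) ^+ j *: f^`(j).
  elim: j => [|j IHj]; first by rewrite scale1r.
  have /(congr1 (-%R \o (@deriv R))) /= := IHj.
  rewrite deriv_comp !derivE -derivnS.
  by rewrite sub0r mulrN1 opprK exprS mulN1r scaleNr.
have /(congr1 (fun p => p.[0])) := derivnE.
rewrite horner_comp !hornerE subr0 nderivn_def !hornerMn => E.
apply: (@mulfI _ j`!%:R); first by rewrite pnatr_eq0 -lt0n fact_gt0.
by rewrite mulrCA !mulr_natl.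
Qed.

Lemma coef_symXn (R : comNzRingType) r (c : R) k :
  ('X^r * (c%:P - 'X) ^+ r : {poly R})`_(r + k) =
  (-1) ^+ k * 'C(r, k)%:R * c ^+ (r - k).
Proof.
rewrite coefXnM ltnNge leq_addr /= addKn exprBn coef_sum.
rewrite (eq_bigr (fun i : 'I_r.+1 => if i == k :> nat
           then (-1) ^+ k * 'C(r, k)%:R * c ^+ (r - k) else 0)); last first.
  move=> i _.
  rewrite -(polyCN 1) -!polyC_exp -polyCM coefMn coefCM coefXn eq_sym.
  case: eqP => [->|_]; last by rewrite mulr0 mul0rn.
  by rewrite mulr1 -[LHS]mulr_natr mulrAC.
rewrite -big_mkcond /=; case: (ltnP k r.+1) => [ltkr | ltrk].
  by rewrite (big_pred1 (Ordinal ltkr)).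
by rewrite bin_small // mulr0 mul0r big1.
Qed.

Lemma sum_odd_indices (V : nmodType) (h : nat -> V) r :
  (forall l, h l.*2 = 0) ->
  \sum_(j < (2 * r).+1) h j = \sum_(l < r) h (2 * l).+1.
Proof.
move=> h0; elim: r => [|r IHr]; first by rewrite big_ord1 big_ord0 -(h0 0%N).
rewrite [RHS]big_ord_recr -IHr mulnS !add2n 2!big_ord_recr /= -addrA.
by congr (_ + _); rewrite -[in RHS](addr0 (h _)) -(h0 r.+1) doubleS -mul2n.
Qed.

(** The value at c is the Beta integral of x^r (c - x)^r over [0, c]. *)
Lemma symXn_primitive (R : numFieldType) r (c : R) : exists F : {poly R},
  [/\ F^`() = 'X^r * (c%:P - 'X) ^+ r, (size F <= (2 * r).+2)%N, F.[0] = 0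
    & F.[c] = c ^+ (2 * r).+1 / ((2 * r).+1 * 'C(2 * r, r))%:R].
Proof.
pose F := \sum_(j < r.+1)
  ((-1) ^+ j * 'C(r, j)%:R * c ^+ (r - j) / (r + j).+1%:R) *: 'X^((r + j).+1)
  : {poly R}.
exists F; split.
- rewrite exprBn mulr_sumr raddf_sum; apply: eq_bigr => j _ /=.
  rewrite derivZ derivXn /= -scaler_nat scalerA mulfVK ?pnatr_eq0 //.
  rewrite -(polyCN 1) -!polyC_exp -polyCM mul_polyC [RHS]mulrnAr.
  by rewrite -[in RHS]scalerAr -exprD -[RHS]scaler_nat scalerA mulrCA mulrA.
- apply: (leq_trans (size_sum _ _ _)); apply/bigmax_leqP => j _.
  apply: (leq_trans (size_scale_leq _ _)).
  by rewrite size_polyXn !ltnS mul2n -addnn leq_add2l -ltnS.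
- by rewrite horner_sum big1 // => j _; rewrite !hornerE exprS mul0r mulr0.
- rewrite horner_sum.
  transitivity (c ^+ (2 * r).+1 *
      \sum_(j < r.+1) (-1) ^+ j * 'C(r, j)%:R / (r + j).+1%:R).
    rewrite mulr_sumr; apply: eq_bigr => j _; rewrite hornerZ hornerXn.
    have <- : (r - j + (r + j).+1 = (2 * r).+1)%N.
      by rewrite addnS addnCA subnK ?mul2n ?addnn // -ltnS.
    by rewrite exprD; ring.
  congr (_ * _); rewrite beta_sum addnn -mul2n.
  have := bin_fact (leq_pmull r (isT : 0 < 2)%N).
  have -> : (2 * r - r = r)%N by rewrite mul2n -addnn addnK.
  move=> binE; rewrite factS -binE mulnA -natrM [X in _ / X]natrM invfM mulrCA.
  by rewrite divff ?mulr1 // pnatr_eq0 -lt0n muln_gt0 fact_gt0.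
Qed.

(** Euler-Maclaurin for f = 'X^r (c - 'X)^r between 0 and c = n.  The symmetry
    of f under x |-> c - x kills the terms where f is differentiated an even
    number of times, so that only odd powers of n remain. *)
Lemma sum_symXn (R : numFieldType) r n (c := n%:R : R) :
  \sum_(k < n) k%:R ^+ r * (c - k%:R) ^+ r =
  c ^+ (2 * r).+1 / ((2 * r).+1 * 'C(2 * r, r))%:R +
  \sum_(s < r) (-1) ^+ r * 'C(r, (2 * s).+1)%:R * bernoulli R (2 * r - 2 * s)
     / (r - s)%:R * c ^+ (2 * s).+1.
Proof.
have [F [dF leF F0 Fc]] := symXn_primitive R r c.
set f := 'X^r * _ in dF.
have fsym : f \Po (c%:P - 'X) = f.
  rewrite /f rmorphM !rmorphXn rmorphB /= comp_polyX comp_polyC.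
  by rewrite subKr mulrC.
transitivity (\sum_(k < n) F^`().[k%:R]).
  by apply: eq_bigr => k _; rewrite dF /f !hornerE.
rewrite (sum_deriv_euler_maclaurin _ _ _ _ leF) big_ord_recl !nderivn0.
rewrite F0 subr0 Fc bernoulli0 mul1r; congr (_ + _).
(* g j is the correction term with f^(j); it contributes to c ^ (2r - j). *)
pose g j := bernoulli R j.+1 * (((-1) ^+ j - 1) * f`_j) / j.+1%:R.
transitivity (\sum_(j < (2 * r).+1) g (2 * r - j)%N).
  rewrite (reindex_inj rev_ord_inj); apply: eq_bigr => j _ /=.
  rewrite subSS /g -mulrA; congr (_ * _); set i := (2 * r - j)%N.
  apply: (@mulIf _ i.+1%:R); first by rewrite pnatr_eq0.
  rewrite mulfVK ?pnatr_eq0 // mulrBl !mulr_natr -!hornerMn -nderivn_deriv dF.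
  rewrite horner_nderivn_reflect // horner_coef0 coef_nderivn addn0 binn.
  by rewrite mulr1n mulrBl mul1r.
rewrite (sum_odd_indices _ (fun j => g (2 * r - j)%N)) => [|l]; last first.
  by rewrite /g -mul2n -mulnBr mul2n -signr_odd odd_double subrr !(mul0r, mulr0).
apply: eq_bigr => s _; have ltsr := ltn_ord s.
have Ej : ((2 * r - (2 * s).+1).+1 = 2 * (r - s))%N.
  by rewrite subnSK ?mulnBr // ltn_pmul2l.
have oddj : odd (2 * r - (2 * s).+1).
  by rewrite -[odd _]negbK -[~~ odd _]/(odd _.+1) Ej mul2n odd_double.
rewrite /g Ej -mulnBr -signr_odd oddj expr1 natrM invfM.
have -> : f`_(2 * r - (2 * s).+1) =
    (-1) ^+ r.-1 * 'C(r, (2 * s).+1)%:R * c ^+ (2 * s).+1.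
  case: (leqP (2 * s).+1 r) => [le2sr | lt2sr]; last first.
    rewrite bin_small // mulr0 mul0r /f coefXnM ifT //.
    by rewrite ltn_subLR ?ltn_pmul2l // mul2n -addnn ltn_add2r.
  have -> : (2 * r - (2 * s).+1 = r + (r - (2 * s).+1))%N.
    by rewrite addnBA // addnn mul2n.
  rewrite coef_symXn subKn // bin_sub //; congr (_ * _ * _).
  have -> : r.-1 = (r - (2 * s).+1 + 2 * s)%N by lia.
  by rewrite exprD exprM sqrrN !expr1n mulr1.
have -> : (-1) ^+ r = - (-1) ^+ r.-1 :> R.
  by rewrite -[in LHS](prednK (leq_ltn_trans (leq0n s) ltsr)) exprS mulN1r.
have nrs : (r - s)%:R != 0 :> R by rewrite pnatr_eq0 subn_eq0 -ltnNge.
by field.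
Qed.

(** Substituting [sum_symXn], the recursion for the coefficients says precisely
    that all powers of n below n ^ (2m+1) cancel. *)
Lemma sumP_diag (R : numFieldType) m n :
  sumP m n (n%:R : R) = n%:R ^+ (2 * m).+1.
Proof.
set c := n%:R : R.
pose a r := ((2 * r).+1 * 'C(2 * r, r))%:R : R.
have a_neq0 r : a r != 0.
  by rewrite pnatr_eq0 muln_eq0 /= -lt0n bin_gt0 leq_pmull.
pose u s r := (-1) ^+ r * 'C(r, (2 * s).+1)%:R * bernoulli R (2 * r - 2 * s)
  / (r - s)%:R * c ^+ (2 * s).+1.
transitivity (\sum_(r < m.+1) coefA R m r *
    (c ^+ (2 * r).+1 / a r + \sum_(s < r) u s r)).
  rewrite /sumP exchange_big; apply: eq_bigr => r _ /=.
  by rewrite -sum_symXn mulr_sumr; apply: eq_bigr => k _; rewrite mulrA.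
under eq_bigr do rewrite mulrDr.
rewrite big_split /=.
pose T s r := coefA R m r * u s r.
have -> : \sum_(r < m.+1) coefA R m r * (\sum_(s < r) u s r) =
    \sum_(s < m) \sum_((2 * s).+1 <= r < m.+1) T s r.
  have T0 s r : (r <= 2 * s)%N -> T s r = 0.
    by move=> le_rs; rewrite /T /u bin_small // !(mulr0, mul0r).
  transitivity (\sum_(r < m.+1) \sum_(s < m) T s r).
    apply: eq_bigr => r _.
    rewrite mulr_sumr (big_ord_widen m (T ^~ r)) ?leq_ord //.
    rewrite big_mkcond; apply: eq_bigr => s _; case: ltnP => // le_rs.
    by rewrite T0 // (leq_trans le_rs) // leq_pmull.
  rewrite exchange_big; apply: eq_bigr => s _ /=.
  rewrite big_geq_mkord [RHS]big_mkcond; apply: eq_bigr => r _ /=.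
  by case: ltnP => // /T0.
rewrite big_ord_recr /= coefA_diag mulrCA (divff (a_neq0 m)) mulr1.
rewrite addrAC -big_split /= big1 ?add0r // => s _.
rewrite coefA_below // -/(a s) mulrAC mulrCA divff // mulr1 mulrC.
rewrite mulr_suml -big_split big_nat_cond big1 //=.
move=> d /andP[/andP[lt_sd _] _].
have -> : T s d = coefA R m d * (- (-1) ^+ d.-1 * 'C(d, (2 * s).+1)%:R *
    bernoulli R (2 * d - 2 * s) / (d - s)%:R * c ^+ (2 * s).+1).
  by rewrite -mulN1r -exprS prednK // (leq_ltn_trans _ lt_sd).
ring.
Qed.

Lemma P_diag (R : numFieldType) m (x : R) : P m x x = x ^+ (2 * m).+1.
Proof.
have diagE (y : R) : (Defs.polyP R m).['X].[y] = P m y y.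
  rewrite /P -[LHS]/(horner_eval y _) -[RHS]/(horner_eval y _) -!horner_map.
  by rewrite /= /horner_eval hornerX hornerC.
suff E : (Defs.polyP R m).['X] = 'X^((2 * m).+1) by rewrite -diagE E hornerXn.
apply: (@poly_eq_nat R _ idfun) => n /=.
by rewrite diagE P_nat sumP_diag hornerXn.
Qed.

Theorem corollary4p13 (R : realType) (m : nat) (q : R) (hq : 1 < q)
    (t : R) (ht : 0 < t) (htq : t `^ q != t) :
  qpower_derive q (fun x => x ^+ (2 * m).+1) t =
    jump_derive_x (qpower_jump q) (P m) (qpower_jump q t) t
    + jump_derive_b (qpower_jump q) (P m) t t.
Proof.
rewrite /qpower_derive /jump_derive_x /jump_derive_b /qpower_jump -mulrDl.
by rewrite addrA subrK !P_diag.
Qed.
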